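(* Fix an imprecise probabilities tree with finite state space $\mathscr{X}$, let $\overline{\mathrm{E}}_{\mathrm V}$ be the corresponding game-theoretic upper expectation and $\underline{\mathrm{E}}_{\mathrm V}(f\vert s)=-\overline{\mathrm{E}}_{\mathrm V}(-f\vert s)$ the conjugate lower expectation. For all $f,g\colon\Omega\to\overline{\mathbb{R}}$, all real $\lambda\ge0$, all $\mu\in\mathbb{R}$ and all situations $s\in\mathscr{X}^{\ast}$: (V1) $\overline{\mathrm{E}}_{\mathrm V}(f\vert s)\le\sup_{\omega\in\Gamma(s)}f(\omega)$; (V2) $\overline{\mathrm{E}}_{\mathrm V}(f+g\vert s)\le\overline{\mathrm{E}}_{\mathrm V}(f\vert s)+\overline{\mathrm{E}}_{\mathrm V}(g\vert s)$; (V3) $\overline{\mathrm{E}}_{\mathrm V}(\lambda f\vert s)=\lambda\overline{\mathrm{E}}_{\mathrm V}(f\vert s)$; (V4) if $f(\omega)\le g(\omega)$ for all $\omega\in\Gamma(s)$, then $\overline{\mathrm{E}}_{\mathrm V}(f\vert s)\le\overline{\mathrm{E}}_{\mathrm V}(g\vert s)$; (V5) $\inf_{\omega\in\Gamma(s)}f(\omega)\le\underline{\mathrm{E}}_{\mathrm V}(f\vert s)\le\overline{\mathrm{E}}_{\mathrm V}(f\vert s)\le\sup_{\omega\in\Gamma(s)}f(\omega)$; (V6) $\overline{\mathrm{E}}_{\mathrm V}(f+\mu\vert s)=\overline{\mathrm{E}}_{\mathrm V}(f\vert s)+\mu$.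
   Context: Notation: $\mathbb{N}=\{1,2,\dots\}$, $\mathbb{N}_0=\mathbb{N}\cup\{0\}$, $\overline{\mathbb{R}}=\mathbb{R}\cup\{-\infty,+\infty\}$, with conventions $+\infty-\infty=-\infty+\infty=+\infty$, $0\cdot(\pm\infty)=0$, $\inf\emptyset=+\infty$. For a non-empty set $\mathscr{Y}$, $\overline{\mathscr{L}}(\mathscr{Y})$ is the set of all maps $\mathscr{Y}\to\overline{\mathbb{R}}$ and $\overline{\mathscr{L}}_b(\mathscr{Y})$ the subset of those bounded below by a real constant. Limits, inequalities and arithmetic of functions are pointwise. Local models: $\mathscr{X}$ is a finite non-empty set. $\mathscr{X}^{\ast}=\bigcup_{n\in\mathbb{N}_0}\mathscr{X}^n$ is the set of situations (finite strings, including the empty string $\Box$). An imprecise probabilities tree assigns to each $s\in\mathscr{X}^{\ast}$ a map $\overline{\mathrm{Q}}_s\colon\overline{\mathscr{L}}(\mathscr{X})\to\overline{\mathbb{R}}$ that is an upper expectation, i.e. satisfies: (E1) $\overline{\mathrm{Q}}_s(c)=c$ for all $c\in\mathbb{R}$; (E2) $\overline{\mathrm{Q}}_s(f+g)\le\overline{\mathrm{Q}}_s(f)+\overline{\mathrm{Q}}_s(g)$ for all $f,g\in\overline{\mathscr{L}}_b(\mathscr{X})$; (E3) $\overline{\mathrm{Q}}_s(\lambda f)=\lambda\overline{\mathrm{Q}}_s(f)$ for all real $\lambda>0$ and $f\in\overline{\mathscr{L}}_b(\mathscr{X})$; (E4) $f\le g\Rightarrow\overline{\mathrm{Q}}_s(f)\le\overline{\mathrm{Q}}_s(g)$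 for all $f,g\in\overline{\mathscr{L}}_b(\mathscr{X})$; (E5) $\lim_n\overline{\mathrm{Q}}_s(f_n)=\overline{\mathrm{Q}}_s(\lim_n f_n)$ for every non-decreasing sequence $\{f_n\}_{n\in\mathbb{N}_0}$ of non-negative variables in $\overline{\mathscr{L}}_b(\mathscr{X})$. Global model: $\Omega=\mathscr{X}^{\mathbb{N}}$ is the set of paths; for $\omega\in\Omega$, $\omega^n\in\mathscr{X}^n$ is the string of its first $n$ values; $\Gamma(x_{1:n})=\{\omega\in\Omega:\omega^n=x_{1:n}\}$. For $g,h\colon\Omega\to\overline{\mathbb{R}}$, $g\ge_s h$ means $g(\omega)\ge h(\omega)$ for all $\omega\in\Gamma(s)$. A supermartingale is a map $\mathscr{M}\colon\mathscr{X}^{\ast}\to\overline{\mathbb{R}}$ with $\overline{\mathrm{Q}}_s(\mathscr{M}(s\,\cdot))\le\mathscr{M}(s)$ for all $s\in\mathscr{X}^{\ast}$, where $\mathscr{M}(s\,\cdot)\in\overline{\mathscr{L}}(\mathscr{X})$ is $x\mapsto\mathscr{M}(sx)$. $\overline{\mathbb{M}}_{\mathrm b}$ is the set of supermartingales bounded below by a real constant, and $\liminf\mathscr{M}(\omega)=\liminf_{n\to+\infty}\mathscr{M}(\omega^n)$. The game-theoretic upper expectation is, for all $f\colon\Omega\to\overline{\mathbb{R}}$ and $s\in\mathscr{X}^{\ast}$, \[\overline{\mathrm{E}}_{\mathrm V}(f\vert s)=\inf\{\mathscr{M}(s):\mathscr{M}\in\overline{\mathbb{M}}_{\mathrm b},\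 \liminf\mathscr{M}\ge_s f\}.\] *)

(* Defs.v *)
(* MathComp-Analysis.

   Addition of extended reals is the dual addition of the library (scope %dE),
   for which +oo - oo = - oo + oo = +oo; the default addition of ereal_scope
   uses the opposite convention. The product satisfies 0 * (+oo) = 0 * (-oo) = 0,
   and ereal_inf set0 = +oo. *)
From mathcomp Require Import all_boot all_order all_algebra.
From mathcomp Require Import all_classical all_reals all_analysis.

Set Implicit Arguments.
Unset Strict Implicit.
Unset Printing Implicit Defensive.

Import Order.TTheory GRing.Theory Num.Theory.

Local Open Scope classical_set_scope.
Local Open Scope ring_scope.
Local Open Scope ereal_scope.

Definition lower_bounded (R : realType) (Y : Type) (h : Y -> \bar R) : Prop :=
  exists B : R, forall y, B%:E <= h y.

Record upper_expectation (R : realType) (X : Type)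
    (Q : (X -> \bar R) -> \bar R) : Prop := UpperExpectation {
  uexp_const : forall c : R, Q (cst c%:E) = c%:E;
  uexp_subadd : forall f g : X -> \bar R,
    lower_bounded f -> lower_bounded g ->
    Q (fun x => (f x + g x)%dE) <= (Q f + Q g)%dE;
  uexp_homog : forall (l : R) (f : X -> \bar R),
    (0 < l)%R -> lower_bounded f ->
    Q (fun x => l%:E * f x) = l%:E * Q f;
  uexp_mono : forall f g : X -> \bar R,
    lower_bounded f -> lower_bounded g ->
    (forall x, f x <= g x) -> Q f <= Q g;
  uexp_continuous : forall f_ : nat -> X -> \bar R,
    (forall n, lower_bounded (f_ n)) ->
    (forall n x, 0 <= f_ n x) ->
    (forall x, nondecreasing_seq (f_ ^~ x)) ->
    Q (f_ n) @[n --> \oo] --> Q (fun x => limn (f_ ^~ x))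
}.

(* A situation is an s : seq X and a path is a w : nat -> X, whose n-th state
   (n >= 1) is w n.-1. *)
Definition imprecise_tree (R : realType) (X : Type)
    (Q : seq X -> (X -> \bar R) -> \bar R) : Prop :=
  forall s, upper_expectation (Q s).

Definition path_prefix (X : Type) (w : nat -> X) (n : nat) : seq X :=
  mkseq w n.

Definition cylinder (X : Type) (s : seq X) : set (nat -> X) :=
  [set w | path_prefix w (size s) = s].

Definition supermartingale (R : realType) (X : Type)
    (Q : seq X -> (X -> \bar R) -> \bar R) (M : seq X -> \bar R) : Prop :=
  forall s, Q s (fun x => M (rcons s x)) <= M s.

Definition liminf_path (R : realType) (X : Type) (M : seq X -> \bar R)
    (w : nat -> X) : \bar R :=
  limn_einf (fun n => M (path_prefix w n)).

Definition upper_EV (R : realType) (X : Type)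
    (Q : seq X -> (X -> \bar R) -> \bar R)
    (f : (nat -> X) -> \bar R) (s : seq X) : \bar R :=
  ereal_inf [set M s | M in [set M : seq X -> \bar R |
    [/\ supermartingale Q M, lower_bounded M &
        forall w, cylinder s w -> f w <= liminf_path M w]]].

Definition lower_EV (R : realType) (X : Type)
    (Q : seq X -> (X -> \bar R) -> \bar R)
    (f : (nat -> X) -> \bar R) (s : seq X) : \bar R :=
  - upper_EV Q (fun w => - f w) s.

(* Main.v *)
(* The constant supermartingales give V1, and sums and positive multiples of
   supermartingales give V2 and V3. The one substantial point is that
   0 <= E(0|s): if M is a supermartingale with M(s) < c then M(sx) < c for some
   x, since otherwise monotonicity would give c <= Q_s(M(s .)) <= M(s); hence
   some path through s keeps M below c, and the limit inferior of M along it is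
   at most c. Together with V2 this yields V5 and V6. *)
Require Import Defs.
From mathcomp Require Import all_boot all_order all_algebra.
From mathcomp Require Import all_classical all_reals all_analysis.
From mathcomp Require Import lra.

Set Implicit Arguments.
Unset Strict Implicit.
Unset Printing Implicit Defensive.

Import Order.TTheory GRing.Theory Num.Theory.
Import DualAddTheory.

Local Open Scope classical_set_scope.
Local Open Scope ring_scope.
Local Open Scope ereal_scope.

(** * Sums and limits inferior of extended reals *)

Section Extended_reals.
Context {R : realType}.
Implicit Types (u v : (\bar R)^nat) (x y c : \bar R).

(** Lets infima be added through real upper bounds of each term. If a summand is [+oo], the
    hypothesis is vacuous, and the dual sum is [+oo] even when the other summand is [-oo]. *)
Lemma lee_dadd_fin c x y :
  (forall r t : R, x < r%:E -> y < t%:E -> c <= (r + t)%:E) ->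
  c <= (x + y)%dE.
Proof.
(* With a summand [-oo], [r] ranges over all reals while [t] stays fixed, which pushes [c] below
   every real. *)
have Nyadd (z : \bar R) : z != +oo ->
    (forall r t : R, -oo < r%:E -> z < t%:E -> c <= (r + t)%:E) -> c = -oo.
  move=> zoo h; have [t zt] : exists t : R, z < t%:E.
    case: z zoo {h} => [z||]; rewrite ?eqxx// => _;
      last by exists 0%R; rewrite ltNyr.
    by exists (z + 1)%R; rewrite lte_fin ltrDl.
  by apply: eq_ninfty => r; rewrite -(subrK t r) h ?ltNyr.
case: x y => [x||] [y||] h //; rewrite ?leey//.
- apply/lee_addgt0Pr => e e0.
  have := h (x + e / 2)%R (y + e / 2)%R; rewrite addrACA -splitr.
  by apply; rewrite lte_fin ltrDl divr_gt0.
- by rewrite (Nyadd x%:E)// => r t rN xt; rewrite addrC h.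
- by rewrite (Nyadd y%:E).
- by rewrite (Nyadd -oo).
Qed.

Lemma limn_einf_ge x u : (forall n, x <= u n) -> x <= limn_einf u.
Proof.
move=> xu; rewrite limn_einf_lim; apply: lime_ge; first exact: is_cvg_einfs.
by apply: nearW => n; apply: le_ereal_inf_tmp => _ [m _ <-].
Qed.

Lemma limn_einf_le x u N : (forall n, (N <= n)%N -> u n <= x) ->
  limn_einf u <= x.
Proof.
move=> ux; rewrite limn_einf_lim; apply: lime_le; first exact: is_cvg_einfs.
apply: nearW => n; apply: ge_ereal_inf.
exists (u (maxn N n)); last by rewrite ux ?leq_maxl.
by exists (maxn N n) => //=; rewrite leq_maxr.
Qed.

(** Tail infima are superadditive; the condition [+?] allows the limit of their sum to be split. *)
Lemma limn_einfD_ge u v : limn_einf u +? limn_einf v ->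
  limn_einf u + limn_einf v <= limn_einf (fun n => u n + v n).
Proof.
rewrite !limn_einf_lim => uv.
have cu := @is_cvg_einfs R u; have cv := @is_cvg_einfs R v.
have cuv := @is_cvg_einfs R (u \+ v).
rewrite -limeD//; apply: lee_lim => //; first exact: is_cvgeD.
apply: nearW => n; apply: le_ereal_inf_tmp => _ [m nm <-].
by apply: leeD; apply: ereal_inf_lbound; exists m.
Qed.

Lemma limn_einfZl_ge (l : R) u : (0 < l)%R ->
  l%:E * limn_einf u <= limn_einf (fun n => l%:E * u n).
Proof.
move=> l0; rewrite !limn_einf_lim.
have cu := @is_cvg_einfs R u; have clu := @is_cvg_einfs R (fun n => l%:E * u n).
rewrite -limeMl//; apply: lee_lim => //; first exact: is_cvgeZl.
apply: nearW => n; apply: le_ereal_inf_tmp => _ [m nm <-].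
by rewrite lee_pmul2l// ?lte_fin//; apply: ereal_inf_lbound; exists m.
Qed.

End Extended_reals.

(** * Gluing growing strings into a path *)

Lemma path_of_prefixes (X : Type) (t : nat -> seq X) (s : seq X) :
  t 0%N = s -> (forall n, exists x, t n.+1 = rcons (t n) x) ->
  exists w : nat -> X, forall n, path_prefix w (size s + n) = t n.
Proof.
move=> t0 tS; pose x0 := projT1 (cid (tS 0%N)).
have sz n : size (t n) = (size s + n)%N.
  elim: n => [|n IH]; first by rewrite t0 addn0.
  by have [x ->] := tS n; rewrite size_rcons IH addnS.
have nthD n m k : (k < size s + n)%N -> nth x0 (t (n + m)%N) k = nth x0 (t n) k.
  move=> kn; elim: m => [|m IH]; first by rewrite addn0.
  rewrite addnS; have [x ->] := tS (n + m)%N.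
  by rewrite nth_rcons sz addnA ltn_addr// IH.
(* Diagonal choice: [t k.+1] has length [size s + k.+1 > k], so the default [x0] is never read, even
   for empty [s]. By [nthD], any other [t n] long enough has the same entry at [k]. *)
exists (fun k => nth x0 (t k.+1) k) => n.
apply: (@eq_from_nth _ x0); first by rewrite size_mkseq sz.
move=> k; rewrite size_mkseq => kn; rewrite nth_mkseq//.
have [kn'|nk] := leqP k.+1 n.
  by rewrite -(subnKC kn') nthD// addnS ltnS leq_addl.
by rewrite -(subnKC (leqW (ltnSE nk))) nthD//.
Qed.

(** * Operations on supermartingales *)

Section Global_upper_expectation.
Context {R : realType} {X : finType} {Q : seq X -> (X -> \bar R) -> \bar R}.
Hypothesis Q_tree : imprecise_tree Q.
Implicit Types (M : seq X -> \bar R) (f g : (nat -> X) -> \bar R) (s : seq X).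

Lemma upper_EV_le f s M : supermartingale Q M -> lower_bounded M ->
  (forall w, cylinder s w -> f w <= liminf_path M w) ->
  upper_EV Q f s <= M s.
Proof. by move=> sM bM fM; apply: ereal_inf_lbound; exists M. Qed.

Lemma upper_EV_lt f s (r : R) : upper_EV Q f s < r%:E ->
  exists M, [/\ supermartingale Q M, lower_bounded M,
    forall w, cylinder s w -> f w <= liminf_path M w & M s < r%:E].
Proof. by case/ereal_inf_lt => _ [M [sM bM fM] <-] Mr; exists M. Qed.

Lemma upper_EV_mono f g s : (forall w, cylinder s w -> f w <= g w) ->
  upper_EV Q f s <= upper_EV Q g s.
Proof.
move=> fg; apply: le_ereal_inf_tmp => _ [M [sM bM gM] <-].
by apply: upper_EV_le => // w sw; rewrite (le_trans (fg _ sw))// gM.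
Qed.

Lemma upper_EV_le_cst f s (c : R) : (forall w, cylinder s w -> f w <= c%:E) ->
  upper_EV Q f s <= c%:E.
Proof.
move=> fc; apply: (@upper_EV_le f s (cst c%:E)).
- by move=> t; rewrite (uexp_const (Q_tree t)).
- by exists c.
- by move=> w /fc /le_trans; apply; exact: limn_einf_ge.
Qed.

Lemma upper_EV_le_sup f s : upper_EV Q f s <= ereal_sup (f @` cylinder s).
Proof.
have fS w : cylinder s w -> f w <= ereal_sup (f @` cylinder s).
  by move=> sw; apply: ereal_sup_ubound; exists w.
case: (ereal_sup _) fS => [c||] fS; rewrite ?leey//.
  exact: upper_EV_le_cst.
(* A constant supermartingale bounded below cannot be [-oo], so every real constant is used
   instead. *)
suff -> : upper_EV Q f s = -oo by [].
apply: eq_ninfty => c; apply: upper_EV_le_cst => w /fS/le_trans; apply.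
exact: leNye.
Qed.

Lemma upper_EV_subadd f g s :
  upper_EV Q (fun w => (f w + g w)%dE) s
    <= (upper_EV Q f s + upper_EV Q g s)%dE.
Proof.
apply: lee_dadd_fin => r t /upper_EV_lt[M [sM [B BM] fM Mr]].
move=> /upper_EV_lt[N [sN [C CN] gN Nt]].
pose L u := (M u + N u)%dE.
have bL u : (B + C)%:E <= L u by rewrite dEFinD; exact: lee_dD.
have LE u : L u = M u + N u.
  (* Lower bounds exclude [-oo], so both additions agree; the same holds below for the limits
     inferior. *)
  apply: dual_addeE_def; rewrite /adde_def.
  by move: (M u) (N u) (BM u) (CN u) => [?||] [?||].
apply: (@le_trans _ _ (L s)); last first.
  by rewrite dEFinD; apply: lee_dD; exact: ltW.
apply: upper_EV_le.
- move=> u; apply: le_trans (lee_dD (sM u) (sN u)).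
  by apply: (uexp_subadd (Q_tree u)); [exists B|exists C].
- by exists (B + C)%R.
- move=> w sw; apply: le_trans (lee_dD (fM w sw) (gN w sw)) _.
  have BlM : B%:E <= liminf_path M w by exact: limn_einf_ge.
  have ClN : C%:E <= liminf_path N w by exact: limn_einf_ge.
  have MN : liminf_path M w +? liminf_path N w.
    rewrite /adde_def.
    by move: (liminf_path M w) (liminf_path N w) BlM ClN => [?||] [?||].
  rewrite dual_addeE_def// (le_trans (limn_einfD_ge MN))//.
  by rewrite /liminf_path (_ : L = M \+ N)//; apply/funext.
Qed.

Lemma upper_EV_le_homog (l : R) f s : (0 < l)%R ->
  upper_EV Q (fun w => l%:E * f w) s <= l%:E * upper_EV Q f s.
Proof.
move=> l0; rewrite -lee_pdivrMl//.
apply: le_ereal_inf_tmp => _ [M [sM [B BM] fM] <-].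
rewrite lee_pdivrMl//.
apply: (@upper_EV_le _ _ (fun u => l%:E * M u)).
- move=> u; rewrite (uexp_homog (Q_tree u))//; last by exists B.
  by rewrite lee_pmul2l// ?lte_fin.
- by exists (l * B)%R => u; rewrite EFinM lee_pmul2l// ?lte_fin.
- move=> w sw; apply: le_trans (limn_einfZl_ge _ l0).
  by rewrite lee_pmul2l// ?lte_fin ?fM.
Qed.

(** The reverse inequality is [upper_EV_le_homog] with factor [l^-1], applied to [l] times [f]. *)
Lemma upper_EV_homog (l : R) f s : (0 < l)%R ->
  upper_EV Q (fun w => l%:E * f w) s = l%:E * upper_EV Q f s.
Proof.
move=> l0; apply/eqP; rewrite eq_le upper_EV_le_homog//=.
rewrite -lee_pdivlMl//.
have lV0 : (0 < l^-1)%R by rewrite invr_gt0.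
apply: le_trans (upper_EV_le_homog _ _ lV0).
apply: upper_EV_mono => w _.
by rewrite muleA -EFinM mulVf ?gt_eqF// mul1e.
Qed.

(** * Paths along which a supermartingale stays small *)

Lemma supermartingale_step M s (c : R) : supermartingale Q M ->
  lower_bounded M -> M s < c%:E -> exists x, M (rcons s x) < c%:E.
Proof.
move=> sM [B BM] Mc; apply: contrapT => /forallNP cM.
suff : c%:E <= M s by rewrite leNgt Mc.
rewrite -(uexp_const (Q_tree s)); apply: le_trans (sM s).
apply: (uexp_mono (Q_tree s)); [by exists c|by exists B|].
by move=> x; rewrite leNgt; apply/negP.
Qed.

Lemma supermartingale_path_lt M s (c : R) : supermartingale Q M ->
  lower_bounded M -> M s < c%:E ->
  exists2 w, cylinder s w & liminf_path M w <= c%:E.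
Proof.
move=> sM bM Mc.
(* [x0] makes the successor function [nx] total: it serves the situations where [M] is not below
   [c]. *)
have [x0 _] := supermartingale_step sM bM Mc.
have /choice[nx nxP] t : exists x, M t < c%:E -> M (rcons t x) < c%:E.
  have [tc|tc] := boolP (M t < c%:E); last by exists x0.
  by have [x xc] := supermartingale_step sM bM tc; exists x.
pose t n := iter n (fun u => rcons u (nx u)) s.
have [|w wt] := @path_of_prefixes X t s erefl.
  by move=> n; exists (nx (t n)).
exists w; first by rewrite /cylinder /= -[X in path_prefix w X]addn0 wt.
apply: (@limn_einf_le _ _ _ (size s)) => n sn.
rewrite -(subnKC sn) wt ltW//.
by elim: (n - size s)%N => //= k; exact: nxP.
Qed.

Lemma upper_EV_cst0_ge0 s : 0 <= upper_EV Q (cst 0) s.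
Proof.
apply: le_ereal_inf_tmp => _ [M [sM bM M0] <-].
rewrite leNgt; apply/negP => Ms0.
(* A real strictly between [M s] and [0]: the path keeps the limit inferior at most [c], and only
   [c < 0] contradicts [M0]. *)
have [c Mc c0] : exists2 c : R, M s < c%:E & (c < 0)%R.
  case: (M s) Ms0 => [r||]//; last by exists (-1)%R; rewrite ?ltNyr ?ltrN10.
  rewrite lte_fin => r0; exists (r / 2)%R; last by rewrite pmulr_llt0.
  by rewrite lte_fin; lra.
have [w sw wc] := supermartingale_path_lt sM bM Mc.
by have := le_trans (M0 _ sw) wc; rewrite lee_fin leNgt c0.
Qed.

Lemma upper_EV_cst0 s : upper_EV Q (cst 0) s = 0.
Proof.
by apply/eqP; rewrite eq_le upper_EV_cst0_ge0 andbT; exact: upper_EV_le_cst.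
Qed.

(** * Lower expectation and real shifts *)

Lemma lower_EV_ge_inf f s : ereal_inf (f @` cylinder s) <= lower_EV Q f s.
Proof.
rewrite /lower_EV leeNr; apply: le_trans (upper_EV_le_sup _ _) _.
by rewrite -ereal_supN -image_comp.
Qed.

(* Here the convention +oo - oo = +oo matters: it makes f - f nonnegative. *)
Lemma lower_EV_le_upper_EV f s : lower_EV Q f s <= upper_EV Q f s.
Proof.
rewrite -dsube_ge0 /lower_EV oppeK; apply: le_trans (upper_EV_subadd _ _ _).
rewrite -[leLHS](upper_EV_cst0 s); apply: upper_EV_mono => w _.
by rewrite dsube_ge0.
Qed.

Lemma upper_EV_le_addr f s (mu : R) :
  upper_EV Q (fun w => (f w + mu%:E)%dE) s <= (upper_EV Q f s + mu%:E)%dE.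
Proof.
apply: le_trans (upper_EV_subadd _ _ _) _.
by apply: lee_dD => //; exact: upper_EV_le_cst.
Qed.

(** Real shifts cancel even at infinite values, so the reverse inequality is [upper_EV_le_addr] for
    the shifted variable and [- mu]. *)
Lemma upper_EV_addr f s (mu : R) :
  upper_EV Q (fun w => (f w + mu%:E)%dE) s = (upper_EV Q f s + mu%:E)%dE.
Proof.
have daddK (x : \bar R) (r : R) : ((x + r%:E) + (- r)%:E)%dE = x.
  by case: x => //= x; congr EFin; exact: addrK.
apply/eqP; rewrite eq_le upper_EV_le_addr/=.
set g := fun w => _.
rewrite -[leRHS](daddK _ (- mu)%R) opprK; apply: lee_dD => //.
apply: le_trans (upper_EV_le_addr g s (- mu)%R).
by apply: upper_EV_mono => w _; rewrite /g daddK.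
Qed.

End Global_upper_expectation.

Theorem proposition13 (R : realType) (X : finType) (X_nonempty : (0 < #|X|)%N)
    (Q : seq X -> (X -> \bar R) -> \bar R) (Q_tree : imprecise_tree Q)
    (f g : (nat -> X) -> \bar R) (lambda : R) (lambda_ge0 : (0 <= lambda)%R)
    (mu : R) (s : seq X) :
  (* V1 *) upper_EV Q f s <= ereal_sup (f @` cylinder s) /\
  (* V2 *) upper_EV Q (fun w => (f w + g w)%dE) s
             <= (upper_EV Q f s + upper_EV Q g s)%dE /\
  (* V3 *) upper_EV Q (fun w => lambda%:E * f w) s
             = lambda%:E * upper_EV Q f s /\
  (* V4 *) ((forall w, cylinder s w -> f w <= g w) ->
             upper_EV Q f s <= upper_EV Q g s) /\
  (* V5 *) [/\ ereal_inf (f @` cylinder s) <= lower_EV Q f s,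
               lower_EV Q f s <= upper_EV Q f s &
               upper_EV Q f s <= ereal_sup (f @` cylinder s)] /\
  (* V6 *) upper_EV Q (fun w => (f w + mu%:E)%dE) s
             = (upper_EV Q f s + mu%:E)%dE.
Proof.
split; first exact: upper_EV_le_sup.
split; first exact: upper_EV_subadd.
split.
  move: lambda_ge0; rewrite le_eqVlt => /predU1P[<-|];
    last exact: upper_EV_homog.
  (* Since [0] times an infinite value is [0], the scaled variable is the constant [0]. *)
  rewrite mul0e -[RHS](upper_EV_cst0 Q_tree s); congr upper_EV.
  by apply/funext => w; rewrite mul0e.
split; first exact: upper_EV_mono.
split; last exact: upper_EV_addr.
split; [exact: lower_EV_ge_inf|exact: lower_EV_le_upper_EV|].
exact: upper_EV_le_sup.
Qed.
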